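(* For every integer $n\geq 1$, $$\sum_{\pi\in\mathfrak{S}_n}x^{\mathrm{exc}(\pi)}q^{\mathrm{cyc}(\pi)+1}=\sum_{\sigma\in\mathcal{CS}_{n+1}}x^{\mathrm{exc}(\sigma)}q^{\mathrm{cyc}(\sigma)}.$$
   Context: Let $\mathfrak{S}_m$ be the set of permutations of $[m]=\{1,\dots,m\}$. For $\pi\in\mathfrak{S}_m$, $\mathrm{exc}(\pi)$ is the number of excedances, i.e. indices $i\in[m]$ with $\pi(i)>i$, and $\mathrm{cyc}(\pi)$ is the number of cycles of $\pi$ (fixed points included). Permutations are written in standard cycle form: each cycle is written with its smallest entry first, and the cycles are written in increasing order of their smallest entries. A cycle succession in $\pi$ is an occurrence of two adjacent entries $i,i+1$, in that order, within the same cycle of the standard cycle form (equivalently, $\pi(i)=i+1$ for some $i\in[m-1]$). For $k\in[m]$, the restriction of $\pi\in\mathfrak{S}_m$ to $[k]$ is obtained from the standard cycle form of $\pi$ by deleting all entries larger than $k$ (and removing empty cycles), keeping the remaining entries in the order in which they appear; it is a permutation of $[k]$ in standard cycle form. The permutation $\pi$ avoids simsun cycle successions if for all $k\in[m]$ the restriction of $\pi$ to $[k]$ contains no cycle successions. $\mathcal{CS}_m$ denotes the set of permutations in $\mathfrak{S}_m$ that avoid simsun cycle successions. For example, $\mathcal{CS}_1=\{(1)\}$, $\mathcal{CS}_2=\{(1)(2)\}$ and $\mathcal{CS}_3=\{(1)(2)(3),(1\,3)(2)\}$. *)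

(* Defs.v *)
From mathcomp Require Import all_boot all_order all_algebra all_fingroup.

Set Implicit Arguments.
Unset Strict Implicit.
Unset Printing Implicit Defensive.

(* Permutations of [m] = {1, ..., m} are elements of 'S_m, that is, permutations
   of 'I_m = {0, ..., m.-1}: the label i of [m] is encoded as i.-1.  Excedances,
   successions and the order on labels are invariant under this shift. *)

Definition exc (m : nat) (s : 'S_m) : nat := #|[set i : 'I_m | i < s i]|.

Definition cyc (m : nat) (s : 'S_m) : nat := #|porbits s|.

(* fingraph.orbit s i is the sequence [:: i; s i; s (s i); ...] running once
   through the cycle of i, and enum 'I_m is increasing. *)
Definition std_cycle_form (m : nat) (s : 'S_m) : seq (seq nat) :=
  [seq [seq val j | j <- fingraph.orbit s i]
     | i <- enum 'I_m & [forall j in porbit s i, i <= j]].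

(* The labels of [k] are encoded as the numbers < k. *)
Definition restrict (k : nat) (C : seq (seq nat)) : seq (seq nat) :=
  [seq c <- [seq [seq a <- c | a < k] | c <- C] | c != [::]].

(* Adjacency is not cyclic: the last and first entries of a cycle are not
   adjacent. *)
Definition has_cycle_succession (C : seq (seq nat)) : bool :=
  has (fun c => has (fun a => infix [:: a; a.+1] c) c) C.

(* k : 'I_m ranges over 0, ..., m.-1, so k.+1 ranges over [m]. *)
Definition avoids_simsun_cycle_successions (m : nat) (s : 'S_m) : bool :=
  [forall k : 'I_m, ~~ has_cycle_succession (restrict k.+1 (std_cycle_form s))].

Definition CS (m : nat) : {set 'S_m} :=
  [set s : 'S_m | avoids_simsun_cycle_successions s].

(* Main.v *)
Require Import Defs.
From mathcomp Require Import all_boot all_order all_algebra all_fingroup.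
Import GRing.Theory.

(** Both sides satisfy the same recursion when the largest label is inserted.

A permutation of [m+1] arises in exactly one way from a permutation [s] of [m]
by inserting the label m+1 in its cycle form: either as a new fixed point, or
right after an old label [i] (lemma [insert_max_bij]).  A fixed point adds one
cycle and no excedance; an insertion after [i] keeps the number of cycles, makes
[i] an excedance and leaves the other old labels alone, so it adds an excedance
exactly when [i] was not one already (lemmas [cyc_insert_max],
[exc_insert_max] and [exc_insert_max_lift]).  Hence a permutation of [m] with e
excedances has e children with e excedances and the same number of cycles,
m - e children with one more excedance, and one child with one more cycle.

Deleting m+1 from the cycle form of such a child gives back the cycle form of
[s] (lemma [restrict_std_insert_max]), so the child avoids simsun cycle
successions as soon as [s] does and the child itself has no succession.  As [s]
has none, only the insertion right after m can create one, and it always does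
(lemma [CS_insert_max]).  The forbidden position m is never an excedance, so a
member of the class on [m] with e excedances has e admissible children with e
excedances, m - 1 - e with one more excedance, and one with an additional cycle.

For m = n + 1 these are the numbers of children of a permutation of [n] with e
excedances.  The two families thus obey the same recursion (lemmas
[sum_perm_growth] and [sum_CS_growth]), starting from the empty permutation on
the left and from the one-cycle permutation (1) on the right: this initial cycle
accounts for the extra factor q.  The induction is carried out for the joint
distribution of (exc, cyc), tested against an arbitrary function of the two
statistics (lemma [sum_perm_CS]), because the recursion changes that function. *)

Set Implicit Arguments.
Unset Strict Implicit.
Unset Printing Implicit Defensive.

(** * Inserting the largest label *)

Section Insertion.

Variables (m : nat) (s : 'S_m) (j : 'I_m.+1).

Let up (a : 'I_m) : 'I_m.+1 := lift ord_max a.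

(** Composing with the transposition puts the new label right after [j] in the
    cycle of [j]; the value [j = ord_max] makes it a fixed point. *)
Definition insert_max : 'S_m.+1 :=
  (tperm ord_max j * lift_perm ord_max ord_max s)%g.

Local Notation t := insert_max.

Lemma insert_max_lift (a : 'I_m) :
  t (lift ord_max a)
  = if lift ord_max a == j then ord_max else lift ord_max (s a).
Proof.
rewrite permM; case: eqP => [->|/eqP neq_aj]; first by rewrite tpermR lift_perm_id.
by rewrite tpermD ?lift_perm_lift ?neq_lift // eq_sym.
Qed.

Lemma insert_max_insertion : t j = ord_max.
Proof. by rewrite permM tpermR lift_perm_id. Qed.

Lemma insert_max_max_at (a : 'I_m) :
  lift ord_max a == j -> t ord_max = lift ord_max (s a).
Proof. by move=> /eqP aj; rewrite permM -aj tpermL lift_perm_lift. Qed.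

(** The orbit under [t] of an old label is obtained from its orbit under [s] by
    replacing each label [a] with [block a]. *)
Let block (a : 'I_m) : seq 'I_m.+1 :=
  if up a == j then [:: up a; ord_max] else [:: up a].

Let expand (p : seq 'I_m) : seq 'I_m.+1 := flatten (map block p).

Let block_last a y : t (last y (block a)) = up (s a).
Proof.
rewrite /block; case: ifP => /= aj; first exact: insert_max_max_at.
by rewrite insert_max_lift aj.
Qed.

Let block_cons a : block a = up a :: behead (block a).
Proof. by rewrite /block; case: ifP. Qed.

Let block_path a : fpath t (up a) (behead (block a)).
Proof.
rewrite /block; case: ifP => //= aj.
by rewrite insert_max_lift aj eqxx.
Qed.

Let expand_path a p : fpath s a p -> fpath t (up a) (behead (expand (a :: p))).
Proof.
elim: p a => [|b p IHp] a.
  by rewrite /expand /= block_cons /= cats0 block_path.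
move=> /= /andP [/eqP ab pathp].
rewrite /expand /= [block a]block_cons /= cat_path block_path /=.
have := IHp _ pathp; rewrite /expand /= [block b]block_cons /= => ->.
rewrite andbT; have := block_last a (up a).
by rewrite {1}block_cons /= => ->; rewrite ab.
Qed.

Let expand_cons a p : expand (a :: p) = up a :: behead (expand (a :: p)).
Proof. by rewrite /expand /= [in LHS]block_cons [block a]block_cons. Qed.

Let expand_last a p y : t (last y (expand (a :: p))) = up (s (last a p)).
Proof.
elim: p a y => [|b p IHp] a y; first by rewrite /expand /= cats0 block_last.
by rewrite [expand _]/(block a ++ expand (b :: p)) last_cat IHp.
Qed.

Let mem_expand_up p a : (up a \in expand p) = (a \in p).
Proof.
elim: p => //= b p IHp; rewrite /expand /= mem_cat IHp inE /block; congr (_ || _).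
by case: ifP => _; rewrite !inE (inj_eq lift_inj) // [_ == ord_max]eq_sym
  (negPf (neq_lift _ _)) orbF.
Qed.

Let mem_expand_max p : (ord_max \in expand p) = (j \in map up p).
Proof.
elim: p => //= b p IHp; rewrite /expand /= mem_cat IHp inE /block; congr (_ || _).
by rewrite [j == _]eq_sym; case: ifP => _; rewrite !inE (negPf (neq_lift _ _)) ?eqxx.
Qed.

Let expand_uniq p : uniq p -> uniq (expand p).
Proof.
elim: p => //= b p IHp /andP [bNp /IHp Up].
rewrite /expand /= cat_uniq Up andbT -all_predC; apply/andP; split.
  by rewrite /block; case: ifP => //= _; rewrite inE eq_sym neq_lift.
apply/allP => y yp /=; apply/negP; rewrite /block.
case: ifP => [/eqP bj|_]; rewrite !inE; last first.
  by move=> /eqP yb; rewrite yb mem_expand_up (negPf bNp) in yp.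
case/orP=> /eqP yb; rewrite yb in yp; first by rewrite mem_expand_up (negPf bNp) in yp.
by rewrite mem_expand_max -bj mem_map ?(negPf bNp) // in yp; exact: lift_inj.
Qed.

(** An orbit is the only duplicate-free cycle of the permutation with the given
    head, so the expanded sequence only has to be such a cycle. *)
Let orbit_expand a : fingraph.orbit t (up a) = expand (fingraph.orbit s a).
Proof.
have Es : fingraph.orbit s a = a :: traject s (s a) (fingraph.order s a).-1.
  by rewrite /fingraph.orbit -fingraph.orderSpred.
set p := traject _ _ _ in Es.
have := cycle_orbit (@perm_inj _ s) a; rewrite Es /= rcons_path.
case/andP=> pathp /eqP lastp.
have cyc_t : fcycle t (expand (a :: p)).
  rewrite expand_cons /= rcons_path expand_path //=.
  have := expand_last a p (up a); rewrite {1}expand_cons /= => ->.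
  by rewrite lastp.
have Up : uniq (expand (a :: p)) by rewrite expand_uniq // -Es orbit_uniq.
rewrite (fingraph.orbitE cyc_t Up) ?mem_expand_up ?inE ?eqxx //.
by rewrite expand_cons /= eqxx rot0.
Qed.

Lemma orbit_insert_max a :
  [seq i <- map val (fingraph.orbit t (lift ord_max a)) | i < m]
  = map val (fingraph.orbit s a).
Proof.
rewrite -/(up a) orbit_expand; elim: (fingraph.orbit s a) => //= b p IHp.
rewrite /expand /= map_cat filter_cat IHp /block.
have bump_m : bump m b = b := lift_max b.
by case: ifP => _; rewrite /= bump_m ltn_ord ?ltnn.
Qed.

End Insertion.

(** * Cycle minima and the number of cycles *)

Definition cycle_min m (s : 'S_m) (i : 'I_m) : bool :=
  [forall j in porbit s i, i <= j].

Lemma mem_orbit_perm m (s : 'S_m) (i j : 'I_m) :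
  (j \in fingraph.orbit s i) = (j \in porbit s i).
Proof.
rewrite -fconnect_orbit; apply/idP/porbitP => [/iter_findex <-|[k ->]].
  by exists (findex s i j); rewrite permX.
by rewrite permX fconnect_iter.
Qed.

Lemma cycle_minE m (s : 'S_m) (i : 'I_m) :
  cycle_min s i = all (leq i) (map val (fingraph.orbit s i)).
Proof.
rewrite all_map; apply/'forall_implyP/allP => H j.
  by rewrite mem_orbit_perm => /H.
by rewrite -mem_orbit_perm => /H.
Qed.

(** The inserted label is larger than all others, so it cannot affect which old
    labels are smallest in their cycles. *)
Lemma cycle_min_lift m (s : 'S_m) (j : 'I_m.+1) (a : 'I_m) :
  cycle_min (insert_max s j) (lift ord_max a) = cycle_min s a.
Proof.
rewrite !cycle_minE lift_max -(orbit_insert_max s j) all_filter.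
apply: eq_all => k /=; case: ltnP => //= le_mk.
by rewrite (leq_trans (ltnW (ltn_ord a))).
Qed.

Lemma cycle_min_max m (s : 'S_m) (j : 'I_m.+1) :
  cycle_min (insert_max s j) ord_max = (j == ord_max).
Proof.
apply/'forall_implyP/eqP => [minmax|jmax i].
  apply/val_inj/eqP; rewrite eqn_leq -ltnS ltn_ord /=; apply: minmax.
  rewrite porbit_sym -{1}(insert_max_insertion s j); exact: (mem_porbit _ 1 j).
case/porbitP=> k ->; rewrite permX; elim: k => //= k IHk.
have -> : iter k (insert_max s j) ord_max = ord_max.
  by apply/val_inj/eqP; rewrite eqn_leq IHk -ltnS ltn_ord.
by rewrite -{1}jmax insert_max_insertion.
Qed.

Lemma has_cycle_min m (s : 'S_m) (i : 'I_m) :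
  exists2 a, cycle_min s a & i \in porbit s a.
Proof.
case: (@arg_minnP _ i (fun a => a \in porbit s i) val (porbit_id s i))
  => a ai mina.
exists a; last by rewrite porbit_sym.
apply/'forall_implyP => j ja; apply: mina.
by rewrite -eq_porbit_mem in ai; rewrite -(eqP ai).
Qed.

(** Each cycle has exactly one smallest element.  Counting cycles by their minima
    turns the effect of an insertion into the appearance of one term in a sum. *)
Lemma cyc_sum m (s : 'S_m) : cyc s = \sum_(i < m) cycle_min s i.
Proof.
have -> : \sum_(i < m) cycle_min s i = #|[set i | cycle_min s i]|.
  by rewrite -sum1dep_card [RHS]big_mkcond; apply: eq_bigr => i _; case: cycle_min.
rewrite -(card_in_imset (f := porbit s)) => [|a b].
  rewrite /cyc; congr #|pred_of_set _|; apply/setP=> A; apply/imsetP/imsetP.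
    case=> i _ ->; have [a mina ai] := has_cycle_min s i; exists a; rewrite ?inE //.
    by apply/eqP; rewrite eq_porbit_mem.
  by case=> a _ ->; exists a.
rewrite !inE => /'forall_implyP mina /'forall_implyP minb Eab.
apply/val_inj/eqP; rewrite eqn_leq mina ?minb //.
  by rewrite -Eab porbit_id.
by rewrite Eab porbit_id.
Qed.

Lemma widen_lift m (a : 'I_m) : widen_ord (leqnSn m) a = lift ord_max a.
Proof. exact/val_inj/esym/lift_max. Qed.

Lemma cyc_insert_max m (s : 'S_m) (j : 'I_m.+1) :
  cyc (insert_max s j) = cyc s + (j == ord_max).
Proof.
rewrite !cyc_sum big_ord_recr /= cycle_min_max; congr (_ + _).
by apply: eq_bigr => a _; rewrite widen_lift cycle_min_lift.
Qed.

(** * Excedances and insertion *)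

Lemma exc_sum m (s : 'S_m) : exc s = \sum_(i < m) (i < s i).
Proof.
by rewrite /exc -sum1dep_card big_mkcond; apply: eq_bigr => i _; case: ltnP.
Qed.

(** The label after which the insertion takes place becomes an excedance, the
    other old labels keep their status, and the largest label is never an
    excedance. *)
Lemma exc_insert_max_sum m (s : 'S_m) (j : 'I_m.+1) :
  exc (insert_max s j) = \sum_(a < m) ((lift ord_max a == j) || (a < s a)).
Proof.
rewrite exc_sum big_ord_recr /= [_ < _]ltnNge -ltnS ltn_ord addn0.
apply: eq_bigr => a _; rewrite widen_lift insert_max_lift.
by case: ifP; rewrite ?lift_max ?ltn_ord.
Qed.

Lemma exc_insert_max m (s : 'S_m) : exc (insert_max s ord_max) = exc s.
Proof.
rewrite exc_insert_max_sum exc_sum; apply: eq_bigr => a _.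
by rewrite eq_sym (negPf (neq_lift _ _)).
Qed.

Lemma exc_insert_max_lift m (s : 'S_m) (b : 'I_m) :
  exc (insert_max s (lift ord_max b)) = exc s + ~~ (b < s b).
Proof.
rewrite exc_insert_max_sum exc_sum (bigD1 b) //= [in RHS](bigD1 b) //= eqxx /=.
have -> : \sum_(i | i != b) ((lift ord_max i == lift ord_max b) || (i < s i))
          = \sum_(i | i != b) (i < s i).
  by apply: eq_bigr => a /negPf nab; rewrite (inj_eq lift_inj) nab.
by rewrite addnAC; case: (b < s b).
Qed.

(** Injectivity suffices by counting.  The position is recovered as the preimage
    of the largest label. *)
Lemma insert_max_bij m :
  bijective (fun p : 'S_m * 'I_m.+1 => insert_max p.1 p.2).
Proof.
apply: inj_card_bij => [[s j] [s' j'] /= E|]; last first.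
  by rewrite card_prod !card_Sn card_ord factS mulnC.
have Ej : j = j'.
  by apply: (@perm_inj _ (insert_max s j)); rewrite {2}E !insert_max_insertion.
rewrite -{}Ej in E *; congr (_, _); apply/permP=> a; move/mulgI: E.
move=> /permP /(_ (lift ord_max a)); rewrite !lift_perm_lift.
exact: lift_inj.
Qed.

(** * Restriction of cycle forms and successions *)

Lemma restrict_restrict k l C : k <= l -> restrict k (restrict l C) = restrict k C.
Proof.
move=> le_kl; rewrite /restrict; elim: C => //= c C IHC.
have Ec : [seq a <- [seq a <- c | a < l] | a < k] = [seq a <- c | a < k].
  rewrite -filter_predI; apply: eq_filter => a /=.
  by case: ltnP => //= lt_ak; rewrite (leq_trans lt_ak).
case: eqP => [c0|_] /=; rewrite ?Ec IHC //.
by rewrite -Ec c0.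
Qed.

Lemma std_cycle_formE m (s : 'S_m) :
  std_cycle_form s
  = [seq map val (fingraph.orbit s i) | i <- enum 'I_m & cycle_min s i].
Proof. by []. Qed.

Lemma std_cycle_form_nonempty m (s : 'S_m) :
  [seq c <- std_cycle_form s | c != [::]] = std_cycle_form s.
Proof.
apply/all_filterP; rewrite all_map; apply/allP=> a _ /=.
by rewrite -size_eq0 size_map size_orbit -lt0n fingraph.order_gt0.
Qed.

Lemma restrict_std m (s : 'S_m) k : m <= k ->
  restrict k (std_cycle_form s) = std_cycle_form s.
Proof.
move=> le_mk; rewrite /restrict -[RHS]std_cycle_form_nonempty; congr filter.
rewrite -[RHS]map_id; apply/eq_in_map => _ /mapP [i _ ->].
apply/all_filterP; rewrite all_map; apply/allP=> b _ /=.
by rewrite (leq_trans (ltn_ord b)).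
Qed.

(** Old labels keep their cycle minima, and inside a cycle the expansion of the
    orbit only adds the new label.  If that label forms a cycle of its own, the
    deletion leaves an empty cycle, which [restrict] removes. *)
Lemma restrict_std_insert_max m (s : 'S_m) (j : 'I_m.+1) :
  restrict m (std_cycle_form (insert_max s j)) = std_cycle_form s.
Proof.
have oldC : [seq [seq a <- c | a < m] | c <-
    [seq map val (fingraph.orbit (insert_max s j) i) | i <-
      [seq lift ord_max i | i <- enum 'I_m & cycle_min s i]]]
    = std_cycle_form s.
  by rewrite std_cycle_formE -!map_comp; apply: eq_map => a; exact: orbit_insert_max.
have newC : cycle_min (insert_max s j) ord_max ->
    [seq a <- map val (fingraph.orbit (insert_max s j) ord_max) | a < m] = [::].
  rewrite cycle_minE => /allP min_max; apply/eqP.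
  rewrite -[_ == _]negbK -has_filter -all_predC.
  by apply/allP=> a /min_max /=; rewrite leqNgt.
rewrite std_cycle_formE enum_ordSr (eq_map (@widen_lift m)) filter_rcons filter_map.
rewrite (eq_filter (a2 := cycle_min s)); last exact: cycle_min_lift.
rewrite /restrict; case: ifP => [/newC max_nil|_]; last first.
  by rewrite oldC std_cycle_form_nonempty.
by rewrite !map_rcons oldC max_nil filter_rcons /= std_cycle_form_nonempty.
Qed.

(** The written form of a cycle omits only the pair (last entry, first entry).
    Its first entry is the smallest of the cycle, so this pair is never of the
    form (i, i+1) and the omission is harmless. *)
Lemma has_cycle_succession_std m (s : 'S_m) :
  has_cycle_succession (std_cycle_form s) = [exists i : 'I_m, s i == i.+1 :> nat].
Proof.
apply/hasP/existsP => [[c /mapP [i _ ->] /hasP [a _ /infixP [p [r E]]]]|[i /eqP si]].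
  have lt_p : (size p).+1 < fingraph.order s i.
    rewrite -(size_orbit s) -(size_map val) E !size_cat /=.
    by rewrite !addnS !ltnS leq_addr.
  have nthE k : k < fingraph.order s i ->
      nth 0 (p ++ [:: a; a.+1] ++ r) k = iter k s i.
    by move=> lt_k; rewrite -E (nth_map i) ?size_orbit // nth_traject.
  exists (iter (size p) s i).
  have := nthE _ lt_p; rewrite nth_cat ltnNge leqnSn subSnn /= => <-.
  by rewrite -nthE ?(ltnW lt_p) // nth_cat ltnn subnn.
have [i0 mini0] := has_cycle_min s i; rewrite -mem_orbit_perm -fconnect_orbit => i0i.
set k := findex s i0 i.
(* If i were the last entry, then i+1 would be the minimum of its cycle. *)
have lt_k : k.+1 < fingraph.order s i0.
  rewrite ltn_neqAle findex_max // andbT; apply/eqP => Ek.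
  have := iter_order (@perm_inj _ s) i0; rewrite -Ek /= iter_findex // => Ei.
  move/'forall_implyP: mini0 => /(_ i).
  rewrite -mem_orbit_perm -fconnect_orbit => /(_ i0i).
  by rewrite -Ei si ltnn.
set c := map val (fingraph.orbit s i0).
have size_c : size c = fingraph.order s i0 by rewrite size_map size_orbit.
have nth_c l : l < fingraph.order s i0 -> nth 0 c l = iter l s i0.
  by move=> lt_l; rewrite (nth_map i0) ?size_orbit // nth_traject.
have Ec : c = take k c ++ [:: val i; (val i).+1] ++ drop k.+2 c.
  rewrite -{1}(cat_take_drop k c) (drop_nth 0) ?size_c 1?ltnW //.
  rewrite (drop_nth 0) ?size_c // !nth_c // 1?ltnW //.
  by rewrite /= iter_findex // si.
exists c.
  by apply/mapP; exists i0 => //; rewrite mem_filter mem_enum andbT.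
apply/hasP; exists (val i); first by rewrite Ec mem_cat inE eqxx orbT.
by apply/infixP; do 2!eexists; exact: Ec.
Qed.

(** Only an insertion right after the previous largest label creates a
    succession; that label is encoded as [m.-1], hence the condition [j.+1 != m].  A
    fixed point ([j = m]) satisfies it, and so does everything when [m = 0]. *)
Lemma CS_insert_max m (s : 'S_m) (j : 'I_m.+1) :
  (insert_max s j \in CS m.+1) = (s \in CS m) && (j.+1 != m).
Proof.
rewrite !inE; have restrE k : k <= m ->
    restrict k (std_cycle_form (insert_max s j)) = restrict k (std_cycle_form s).
  by move=> le_km; rewrite -(restrict_restrict _ le_km) restrict_std_insert_max.
have -> : avoids_simsun_cycle_successions (insert_max s j)
   = avoids_simsun_cycle_successions s
     && ~~ has_cycle_succession (std_cycle_form (insert_max s j)).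
  apply/forallP/andP => [av | [/forallP avs avt] k].
    split; last by have := av ord_max; rewrite restrict_std.
    by apply/forallP => k; have := av (lift ord_max k); rewrite lift_max restrE.
  case: (unliftP ord_max k) => [k' ->|->]; last by rewrite restrict_std.
  by rewrite lift_max restrE.
case: (boolP (avoids_simsun_cycle_successions s)) => //= /forallP avs.
rewrite has_cycle_succession_std; congr (~~ _).
apply/existsP/eqP => [[a]|jm].
  case: (unliftP ord_max a) => [a' ->|->]; last first.
    by rewrite eqn_leq [_.+1 <= _]leqNgt ltn_ord andbF.
  rewrite insert_max_lift lift_max; case: (lift ord_max a' =P j) => [<- /eqP|_ /eqP sa].
    by rewrite lift_max => /esym.
  (* The restriction of s to all its labels is s, so s has no succession. *)
  case: m s j avs a' sa {restrE a} => [|m] s j avs a' sa; first by have := ltn_ord a'.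
  have := avs ord_max; rewrite restrict_std // has_cycle_succession_std.
  by case/existsP; exists a'; move: sa; rewrite !lift_max => ->.
by exists j; rewrite insert_max_insertion jm.
Qed.

(** * The common recursion *)

Section Enumeration.

Local Open Scope ring_scope.

Variable V : nmodType.

Lemma sum_insert_max m (F : 'S_m.+1 -> V) (P : pred 'S_m.+1) :
  \sum_(t | P t) F t
  = \sum_(s : 'S_m) \sum_(j | P (insert_max s j)) F (insert_max s j).
Proof.
rewrite (reindex _ (onW_bij _ (insert_max_bij m))) /=.
by rewrite pair_big_dep.
Qed.

Lemma sum_bool_shift k (P : pred 'I_k) (f : nat -> V) e c :
  (\sum_(i < k) P i)%N = c ->
  \sum_(i < k) f (e + ~~ P i)%N = f e *+ c + f e.+1 *+ (k - c).
Proof.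
move=> sumP; have <- : (\sum_(i < k) ~~ P i = k - c)%N.
  apply: (@addnI c); rewrite -{1}sumP -big_split subnKC /=.
    rewrite (eq_bigr (fun=> 1%N)) ?sum1_card ?card_ord // => i _.
    by case: (P i).
  rewrite -sumP -[leqRHS](card_ord k) -sum1_card.
  by apply: leq_sum => i _; exact: leq_b1.
rewrite -sumP.
rewrite -!sumrMnr -big_split; apply: eq_bigr => i _.
by case: (P i); rewrite /= ?addn0 ?addn1 ?addr0 ?add0r.
Qed.

(** Total contribution of the children of a permutation with [e] excedances and
    [c] cycles: [k] counts the admissible old labels after which to insert, among
    which are all [e] excedances, and the last term is the new fixed point. *)
Definition growth (k : nat) (F : nat -> nat -> V) (e c : nat) : V :=
  F e c *+ e + F e.+1 c *+ (k - e) + F e c.+1.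

Lemma sum_perm_growth m (F : nat -> nat -> V) :
  \sum_(t : 'S_m.+1) F (exc t) (cyc t) = \sum_(s : 'S_m) growth m F (exc s) (cyc s).
Proof.
rewrite sum_insert_max; apply: eq_bigr => s _.
rewrite big_ord_recr /= exc_insert_max cyc_insert_max eqxx addn1; congr (_ + _).
rewrite -(sum_bool_shift (fun e => F e (cyc s)) _ (esym (exc_sum s))).
apply: eq_bigr => b _; rewrite widen_lift exc_insert_max_lift cyc_insert_max.
by rewrite eq_sym (negPf (neq_lift _ _)) addn0.
Qed.

(** Of the [m.+1] old labels the largest one is forbidden.  It is not an
    excedance, so [m] positions containing all excedances remain. *)
Lemma sum_CS_growth m (F : nat -> nat -> V) :
  \sum_(t in CS m.+2) F (exc t) (cyc t)
  = \sum_(s in CS m.+1) growth m F (exc s) (cyc s).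
Proof.
rewrite sum_insert_max [RHS]big_mkcond; apply: eq_bigr => s _.
under eq_bigl => j do rewrite CS_insert_max.
case: ifP => _ /=; last by rewrite big_pred0_eq.
rewrite big_mkcond /= !big_ord_recr /= eqxx addr0 gtn_eqF //=.
rewrite exc_insert_max cyc_insert_max eqxx addn1; congr (_ + _).
have excE : (\sum_(i < m)
    (widen_ord (leqnSn m) i < s (widen_ord (leqnSn m) i)) = exc s)%N.
  by rewrite exc_sum big_ord_recr /= [(m < _)%N]ltnNge -ltnS ltn_ord addn0.
rewrite -(sum_bool_shift (fun e => F e (cyc s)) _ excE).
apply: eq_bigr => b _; rewrite eqSS ltn_eqF ?ltnS ?ltn_ord //=.
rewrite widen_lift exc_insert_max_lift cyc_insert_max.
by rewrite eq_sym (negPf (neq_lift _ _)) addn0.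
Qed.

Lemma sum_perm_CS n (F : nat -> nat -> V) :
  \sum_(s : 'S_n) F (exc s) (cyc s).+1 = \sum_(t in CS n.+1) F (exc t) (cyc t).
Proof.
(* The recursion replaces F by a shifted growth of F: F must be generalized. *)
elim: n F => [|n IHn] F; last first.
  rewrite sum_CS_growth -IHn.
  by rewrite (sum_perm_growth n (fun e c => F e c.+1)).
rewrite sum_insert_max; apply: eq_bigr => s _.
under eq_bigl => j do rewrite CS_insert_max.
have -> /= : s \in CS 0 by rewrite inE; apply/forallP; case.
rewrite big_mkcond big_ord_recr big_ord0 /= add0r.
by rewrite exc_insert_max cyc_insert_max eqxx addn1.
Qed.

End Enumeration.

Local Open Scope ring_scope.

Theorem theorem7 (R : comNzRingType) (x q : R) (n : nat) (hn : (1 <= n)%N) :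
  \sum_(s : 'S_n) x ^+ exc s * q ^+ (cyc s + 1)%N
  = \sum_(s in CS n.+1) x ^+ exc s * q ^+ cyc s.
Proof.
under eq_bigr do rewrite addn1.
exact: sum_perm_CS (fun e c => x ^+ e * q ^+ c).
Qed.
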